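(* Let $\mathcal{K}$ be a mean whose domain contains bounded sets only, and let $\hat{\mathcal{K}}$ be its extension. If $\mathcal{K}$ is disjoint-monotone, then $\hat{\mathcal{K}}$ is disjoint-monotone.
   Context: A (generalized) mean is a function $\mathcal{K}: Dom(\mathcal{K})\to\bar{\mathbb{R}}=\mathbb{R}\cup\{-\infty,+\infty\}$, where $Dom(\mathcal{K})$ is a collection of nonempty subsets of $\mathbb{R}$, with $\inf H\le\mathcal{K}(H)\le\sup H$ for all $H\in Dom(\mathcal{K})$ (so values on bounded sets are real). Standing assumption on the domain of the original mean $\mathcal{K}$: it is closed under finite unions and nonempty finite intersections, and if $H\in Dom(\mathcal{K})$ and $I$ is a (finite or infinite) interval with $H\cap I\neq\emptyset$ then $H\cap I\in Dom(\mathcal{K})$. Extension: let $\mathcal{K}$ be a mean whose domain contains bounded sets only. Let $\emptyset\neq H\subset\mathbb{R}$ be such that $H\cap[x,y]\in Dom(\mathcal{K})$ for all real $x\le y$ with $H\cap[x,y]\neq\emptyset$. Set $\hat{\mathcal{K}}(H)=\lim_{x\to-\infty,\,y\to+\infty}\mathcal{K}(H\cap[x,y])$ if this double limit (with $x,y$ tending independently) exists in $\bar{\mathbb{R}}$; $Dom(\hat{\mathcal{K}})$ consists of all such $H$ for which the limit exists. A mean $\mathcal{M}$ is disjoint-monotone if for all disjoint $H_1,H_2$ with $H_1,H_2,H_1\cup H_2\in Dom(\mathcal{M})$, $\mathcal{M}(H_1)\le\mathcal{M}(H_2)$ implies $\mathcal{M}(H_1)\le\mathcal{M}(H_1\cup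 H_2)\le\mathcal{M}(H_2)$. *)

(* Defs.v *)
From HB Require Import structures.
From mathcomp Require Import all_boot all_order all_algebra.
From mathcomp Require Import all_classical all_reals all_analysis.
Set Implicit Arguments.
Unset Strict Implicit.
Unset Printing Implicit Defensive.
Import Order.TTheory GRing.Theory Num.Theory.
Import numFieldNormedType.Exports.
Local Open Scope classical_set_scope.
Local Open Scope ring_scope.

(* A generalized mean. [mean_val] is a total function, but its values outside
   [mean_dom] are irrelevant. *)
Record mean (R : realType) := Mean {
  mean_dom : set (set R);
  mean_val : set R -> \bar R;
  mean_dom_neq0 : forall H, mean_dom H -> H !=set0;
  mean_val_bounds : forall H, mean_dom H ->
    (ereal_inf (EFin @` H) <= mean_val H <= ereal_sup (EFin @` H))%E
}.

Definition admissible_dom (R : realType) (K : mean R) : Prop :=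
  [/\ forall A B, mean_dom K A -> mean_dom K B -> mean_dom K (A `|` B),
      forall A B, mean_dom K A -> mean_dom K B -> A `&` B !=set0 ->
        mean_dom K (A `&` B) &
      forall (A : set R) (I : interval R), mean_dom K A ->
        A `&` [set` I] !=set0 -> mean_dom K (A `&` [set` I])].

Definition bounded_dom (R : realType) (K : mean R) : Prop :=
  forall H, mean_dom K H -> bounded_set H.

(* The product filter lets x tend to -oo and y to +oo independently.  Windows missing
   [H] (where [mean_val K] is junk) do not affect the limit: see [near_window]. *)
Definition window_filter (R : realType) (K : mean R) (H : set R) :
    set_system (\bar R) :=
  (fun p : R * R => mean_val K (H `&` [set` `[p.1, p.2]]))
    @ filter_prod (ninfty_nbhs R) (pinfty_nbhs R).

Definition ext_dom (R : realType) (K : mean R) : set (set R) :=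
  [set H | [/\ H !=set0,
      forall x y : R, x <= y -> H `&` [set` `[x, y]] !=set0 ->
        mean_dom K (H `&` [set` `[x, y]]) &
      cvg (window_filter K H)]].

Definition ext_val (R : realType) (K : mean R) (H : set R) : \bar R :=
  lim (window_filter K H).

Lemma ext_dom_neq0 (R : realType) (K : mean R) (H : set R) :
  ext_dom K H -> H !=set0.
Proof. by case. Qed.

Lemma near_window (R : realType) (K : mean R) (H : set R) : ext_dom K H ->
  \forall p \near filter_prod (ninfty_nbhs R) (pinfty_nbhs R),
    mean_dom K (H `&` [set` `[p.1, p.2]]).
Proof.
move=> [[a Ha] Hdom _].
exists ([set x | x < a], [set y | a < y]) => /=.
  by split; [exact/nbhs_ninfty_lt/num_real | exact/nbhs_pinfty_gt/num_real].
move=> [x y] /= [xa ay]; apply: Hdom.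
  exact: ltW (lt_trans xa ay).
by exists a; split=> //=; rewrite in_itv /= !ltW.
Qed.

Lemma ext_val_bounds (R : realType) (K : mean R) (H : set R) : ext_dom K H ->
  (ereal_inf (EFin @` H) <= ext_val K H <= ereal_sup (EFin @` H))%E.
Proof.
move=> HH; have [_ _ cvgH] := HH; apply/andP; split.
- apply: lime_ge => //.
  apply: filterS (near_window HH) => p /mean_val_bounds/andP[+ _].
  by apply: le_trans; apply: ereal_inf_le_tmp; apply: image_subset => z [].
- apply: lime_le => //.
  apply: filterS (near_window HH) => p /mean_val_bounds/andP[_].
  by move/le_trans; apply; apply: ereal_sup_le; apply: image_subset => z [].
Qed.

Definition extension (R : realType) (K : mean R) : mean R :=
  @Mean R (ext_dom K) (ext_val K) (@ext_dom_neq0 R K) (@ext_val_bounds R K).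

Definition disjoint_monotone (R : realType) (M : mean R) : Prop :=
  forall H1 H2 : set R, H1 `&` H2 = set0 ->
    mean_dom M H1 -> mean_dom M H2 -> mean_dom M (H1 `|` H2) ->
    (mean_val M H1 <= mean_val M H2)%E ->
    (mean_val M H1 <= mean_val M (H1 `|` H2) <= mean_val M H2)%E.

(* Main.v *)
Require Import Defs.
From mathcomp Require Import all_boot all_order all_algebra.
From mathcomp Require Import all_classical all_reals all_analysis.
Import Order.TTheory numFieldNormedType.Exports.
Local Open Scope classical_set_scope.
Local Open Scope ring_scope.

(** Disjoint-monotonicity is symmetric in the two sets: since values in the
    extended line are comparable, it says that the mean of a disjoint union lies
    between the minimum and the maximum of the two means
    ([disjoint_monotone_between]).  In this form no hypothesis compares the two
    means, so the inequality holds for the traces of [H1] and [H2] on every large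
    window [[x, y]], even when the order of the means of these traces varies with
    the window, as it may when the extended means of [H1] and [H2] coincide.
    As min and max are continuous on the extended line, the inequality passes to
    the limit over windows, where the assumed order between the extended means
    identifies the min and the max. *)

Lemma disjoint_monotone_between (R : realType) (M : mean R) (H1 H2 : set R) :
    disjoint_monotone M -> H1 `&` H2 = set0 ->
    mean_dom M H1 -> mean_dom M H2 -> mean_dom M (H1 `|` H2) ->
  (Order.min (mean_val M H1) (mean_val M H2) <= mean_val M (H1 `|` H2)
     <= Order.max (mean_val M H1) (mean_val M H2))%E.
Proof.
move=> hM H12 d1 d2 d12; have /orP[le12|le21] := le_total (mean_val M H1) (mean_val M H2).
  by rewrite min_l// max_r//; exact: hM.
by rewrite min_r// max_l// setUC; apply: hM; rewrite // 1?setIC // setUC.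
Qed.

Theorem proposition4p16 (R : realType) (K : mean R)
    (hDom : admissible_dom K) (hBdd : bounded_dom K)
    (hK : disjoint_monotone K) :
  disjoint_monotone (extension K).
Proof.
move=> H1 H2 H12 d1 d2 d12 /= le12.
pose F := filter_prod (ninfty_nbhs R) (pinfty_nbhs R).
pose k (H : set R) (p : R * R) := mean_val K (H `&` [set` `[p.1, p.2]]).
have cvgk H : ext_dom K H -> k H p @[p --> F] --> ext_val K H by case.
have between : \forall p \near F,
    (Order.min (k H1 p) (k H2 p) <= k (H1 `|` H2) p
       <= Order.max (k H1 p) (k H2 p))%E.
  apply: filterS3 (near_window d1) (near_window d2) (near_window d12).
  move=> p w1 w2; rewrite /k !setIUl => w12.
  apply: disjoint_monotone_between => //.
  by rewrite setIACA H12 set0I.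
have cvg_min : Order.min (k H1 p) (k H2 p) @[p --> F] --> ext_val K H1.
  rewrite -[X in _ --> X](min_l le12).
  apply: continuous2_cvg (cvgk _ d1) (cvgk _ d2).
  exact: (@min_continuous _ (\bar R) (ext_val K H1, ext_val K H2)).
have cvg_max : Order.max (k H1 p) (k H2 p) @[p --> F] --> ext_val K H2.
  rewrite -[X in _ --> X](max_r le12).
  apply: continuous2_cvg (cvgk _ d1) (cvgk _ d2).
  exact: (@max_continuous _ (\bar R) (ext_val K H1, ext_val K H2)).
apply/andP; split.
- by apply: lee_cvg_to cvg_min (cvgk _ d12) _; apply: filterS between => p /andP[].
- by apply: lee_cvg_to (cvgk _ d12) cvg_max _; apply: filterS between => p /andP[].
Qed.
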